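(* If $T$ is a tree on at least three vertices, then $\chi_{\mu_i}(T)=\chi_\mu(T)$.
   Context: All graphs are finite and simple. A geodesic is a shortest path. For $X\subseteq V(G)$, two vertices $x,y\in X$ are $X$-visible if some $x,y$-geodesic has no internal vertex in $X$. $X$ is a mutual-visibility (MV) set if every two of its vertices are $X$-visible, and an independent mutual-visibility (IMV) set if moreover it is independent. $\chi_\mu(G)$ (resp. $\chi_{\mu_i}(G)$) is the least $k$ such that $V(G)$ can be partitioned into $k$ MV sets (resp. IMV sets). *)

(* Defs.v *)
From mathcomp Require Import all_boot.

Set Implicit Arguments.
Unset Strict Implicit.
Unset Printing Implicit Defensive.

Section Graph.

Variables (T : finType) (e : rel T).

Definition simple_graph : Prop := symmetric e /\ irreflexive e.

Definition graph_connected : Prop := 0 < #|T| /\ forall x y, connect e x y.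

Definition acyclic : Prop := forall c : seq T, 2 < size c -> ~ ucycle e c.

Definition tree : Prop := [/\ simple_graph, graph_connected & acyclic].

(* The vertices of the path are x :: p, so its length is size p. *)
Definition spath (x y : T) (p : seq T) : bool :=
  [&& path e x p, uniq (x :: p) & last x p == y].

Definition geodesic (x y : T) (p : seq T) : bool :=
  spath x y p && [forall n : 'I_(size p), forall q : n.-tuple T, ~~ spath x y q].

Lemma geodesicP x y p :
  reflect (spath x y p /\ forall q, spath x y q -> size p <= size q)
          (geodesic x y p).
Proof.
apply: (iffP andP) => -[xyp min_p]; split=> //.
  move=> q xyq; rewrite leqNgt; apply/negP=> lt_qp.
  by have /forallP/(_ (in_tuple q)) := forallP min_p (Ordinal lt_qp); rewrite xyq.
apply/forallP=> n; apply/forallP=> q; apply/negP=> /min_p.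
by rewrite size_tuple leqNgt ltn_ord.
Qed.

Definition internal (x : T) (p : seq T) : seq T := behead (belast x p).

(* The bound on n only makes the quantifier finite; see visibleP. *)
Definition visible (X : {set T}) (x y : T) : bool :=
  [exists n : 'I_#|T|, exists p : n.-tuple T,
     geodesic x y p && all [predC X] (internal x p)].

Lemma visibleP (X : {set T}) x y :
  reflect (exists2 p, geodesic x y p & forall z, z \in internal x p -> z \notin X)
          (visible X x y).
Proof.
apply: (iffP existsP) => [[n /existsP[p /andP[geo_p /allP Xp]]] | [p geo_p Xp]].
  by exists p.
have lt_pT : size p < #|T|.
  have /geodesicP[/and3P[_ Up _] _] := geo_p.
  by rewrite -[(size p).+1]/(size (x :: p)) -(card_uniqP Up) max_card.
exists (Ordinal lt_pT); apply/existsP; exists (in_tuple p).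
by rewrite geo_p; apply/allP.
Qed.

Definition mv_set (X : {set T}) : bool :=
  [forall x in X, forall y in X, (x != y) ==> visible X x y].

(* Restricting to x != y changes nothing when e is irreflexive; it lets
   singletons be independent for every e, so that chi_mui below is total. *)
Definition independent (X : {set T}) : bool :=
  [forall x in X, forall y in X, (x != y) ==> ~~ e x y].

Definition imv_set (X : {set T}) : bool := mv_set X && independent X.

Definition partitionable (S : pred {set T}) (k : nat) : bool :=
  [exists P : {set {set T}},
     [&& partition P [set: T], #|P| == k & [forall X in P, S X]]].

Lemma ex_partitionable (S : pred {set T}) :
  (forall x, S [set x]) -> exists k, partitionable S k.
Proof.
move=> S1; pose P := [set [set x] | x : T]; exists #|P|.
apply/existsP; exists P; rewrite eqxx /=; apply/andP; split; last first.
  by apply/forallP=> X; apply/implyP=> /imsetP[x _ ->].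
apply/and3P; split.
- rewrite cover_imset; apply/eqP/setP=> x; rewrite inE.
  by apply/bigcupP; exists x; rewrite ?inE.
- apply/trivIsetP=> _ _ /imsetP[x _ ->] /imsetP[y _ ->] neq_xy.
  by rewrite disjoints1 inE; apply: contraNneq neq_xy => ->.
- by apply/imsetP=> -[x _ /setP/(_ x)]; rewrite !inE eqxx.
Qed.

Lemma mv_set1 x : mv_set [set x].
Proof.
apply/forall_inP=> y /set1P->; apply/forall_inP=> z /set1P->.
by rewrite eqxx.
Qed.

Lemma imv_set1 x : imv_set [set x].
Proof.
rewrite /imv_set mv_set1; apply/forall_inP=> y /set1P->.
by apply/forall_inP=> z /set1P->; rewrite eqxx.
Qed.

Definition chi_mu : nat := ex_minn (ex_partitionable mv_set1).

Definition chi_mui : nat := ex_minn (ex_partitionable imv_set1).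

End Graph.

(* Main.v *)
(* An MV set of a tree that contains an edge xy is {x, y}: any further vertex
   sees one of x, y only through the other. Since the tree has a third vertex, a
   partition with such a class has another class Z, and {x, y} together with Z
   can be split again into two IMV sets. If Z meets both sides of the edge, give
   y the part of Z on the side of x and conversely. If Z lies on the side of x,
   either Z + y and {x} work, or some z' in Z separates x from another vertex of
   Z, hence from all of Z - z', and then {y, z'} and Z - z' + x work. Each
   exchange keeps the number of classes and lowers the number of dependent
   ones. *)
Require Import Defs.
From mathcomp Require Import all_boot.

Section Betweenness.

Set Implicit Arguments.
Unset Strict Implicit.
Unset Printing Implicit Defensive.

Variables (T : finType) (e : rel T).

(** * Betweenness as separation by a vertex *)

Definition avoid (b : T) : rel T := fun u v => [&& e u v, u != b & v != b].

(** The vertex [b] separates [a] from [c], endpoints included; in a tree, it lies on the unique path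
    joining them. Phrasing this through [connect] makes [btw_tri] a matter of transitivity. *)
Definition btw (a b c : T) : bool :=
  [|| a == b, c == b | ~~ connect (avoid b) a c].

Lemma path_avoid b a p :
  path e a p -> b \notin a :: p -> path (avoid b) a p.
Proof.
elim: p a => //= v p IHp a /andP[eav pP]; rewrite !inE !negb_or.
case/and3P=> ba bv bp; rewrite {1}/avoid eav (eq_sym a) ba (eq_sym v) bv /=.
by apply: IHp => //; rewrite inE negb_or bv.
Qed.

Lemma btwP a b c :
  reflect (forall p, path e a p -> last a p = c -> b \in a :: p) (btw a b c).
Proof.
apply: (iffP idP) => [abc p pP lp | bP].
  apply: contraLR abc => bNp; rewrite /btw !negb_or negbK.
  apply/and3P; split.
  - by apply: contraNneq bNp => ->; rewrite inE eqxx.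
  - by apply: contraNneq bNp => <-; rewrite -lp mem_last.
  - by apply/connectP; exists p; rewrite ?path_avoid.
apply/negPn/negP; rewrite /btw !negb_or negbK => /and3P[ab _ /connectP[p pP lp]].
have /(bP p): path e a p by apply: sub_path pP => u v /and3P[].
move/(_ (esym lp)); rewrite inE eq_sym (negPf ab) /=.
elim: p a {ab lp bP} pP => //= v p IHp a /andP[/and3P[_ _ vb] pP].
by rewrite inE eq_sym (negPf vb) /=; apply: IHp pP.
Qed.

(** If [b] separates neither [a] from [d] nor [d] from [c], two walks avoiding [b] meet at [d]. This
    transfers a separation to a further vertex [d] and drives most case analyses below. *)
Lemma btw_tri d a b c : btw a b c -> btw a b d || btw d b c.
Proof.
apply: contraLR; rewrite negb_or /btw !negb_or !negbK.
case/andP=> /and3P[-> _ ad] /and3P[_ -> dc] /=.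
exact: connect_trans ad dc.
Qed.

Lemma btw_edge a b c : btw a b c -> b != a -> b != c -> ~~ e a c.
Proof.
move=> /btwP abc ba bc; apply/negP=> eac.
by have := abc [:: c]; rewrite /= eac !inE (negPf ba) (negPf bc) => /(_ isT erefl).
Qed.

(** * Betweenness in a tree *)

Hypothesis treeT : tree e.

Let e_sym : symmetric e. Proof. by case: treeT => -[]. Qed.
Let e_irr : irreflexive e. Proof. by case: treeT => -[]. Qed.

Lemma avoid_sym b : symmetric (avoid b).
Proof. by move=> u v; rewrite /avoid e_sym; congr andb; rewrite andbC. Qed.

Lemma btw_sym a b c : btw a b c = btw c b a.
Proof. by rewrite /btw orbCA (sym_connect_sym (@avoid_sym b)). Qed.

Lemma spath_exists a c : exists p, spath e a c p.
Proof.
case: treeT => _ [_ /(_ a c) /connectP[p pP ->]] _.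
case: (shortenP pP) => q qP Uq _; exists q.
by rewrite /spath qP Uq eqxx.
Qed.

(* Otherwise the neighbours of b on p are joined by a path avoiding b, which b
   closes into a cycle. *)
Lemma spath_btw a c p b : spath e a c p -> b \in a :: p -> btw a b c.
Proof.
case/and3P=> pP Up /eqP lp bp; apply/negPn/negP.
rewrite /btw !negb_or negbK => /and3P[ab cb conn_ac].
move: bp; rewrite inE eq_sym (negPf ab) /= => bp.
case/splitPr: bp pP Up lp => p1 [|v p2].
  by rewrite last_cat /= => _ _ bc; rewrite bc eqxx in cb.
rewrite -cat_cons cat_uniq cat_path last_cat /= => /and4P[p1P ub bv p2P].
case/and3P=> /andP[_ _] dis /and3P[bNvp2 _ _] lp.
have /hasPn disP : ~~ has (mem (a :: p1)) (b :: v :: p2) by [].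
have bNp1 : b \notin a :: p1 by apply: disP; rewrite mem_head.
have vNp1 : v \notin a :: p1 by apply: disP; rewrite !inE eqxx orbT.
have conn_au : connect (avoid b) a (last a p1).
  by apply/connectP; exists p1; rewrite ?path_avoid.
have conn_vc : connect (avoid b) v c.
  by apply/connectP; exists p2; rewrite ?path_avoid.
have conn_uv : connect (avoid b) (last a p1) v.
  rewrite (sym_connect_sym (@avoid_sym b)) in conn_au.
  rewrite (sym_connect_sym (@avoid_sym b)) in conn_vc.
  exact: connect_trans (connect_trans conn_au conn_ac) conn_vc.
have neq_uv : last a p1 != v.
  by apply: contraNneq vNp1 => <-; apply: mem_last.
have ub_neq : last a p1 != b.
  by apply: contraNneq bNp1 => <-; apply: mem_last.
move: (last a p1) conn_uv ub neq_uv ub_neq => u /connectP[q0 q0P lq0] ub neq_uv ub_neq.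
move: lq0; case: (shortenP q0P) => q qP Uq _ lq.
case: treeT => _ _ /(_ [:: b, u & q]) [].
  (* As [u] and [v] differ, [q] is nonempty, so the cycle has at least three vertices. *)
  by case: q lq {qP Uq} neq_uv => //= ->; rewrite eqxx.
have qPe : path e u q by apply: sub_path qP => ? ? /and3P[].
have bNq : b \notin u :: q.
  rewrite inE eq_sym negb_or ub_neq /=.
  elim: q u {Uq lq neq_uv ub ub_neq qPe q0P} qP => //= w q IHq u /andP[/and3P[_ _ wb] /IHq].
  by rewrite inE eq_sym negb_or wb.
apply/andP; split; last by rewrite cons_uniq bNq.
by rewrite /= rcons_path qPe -lq e_sym ub e_sym bv.
Qed.

(** On a simple path from [a] to [c], the part up to an earlier vertex [b] misses [c], so [c] is not
    between [a] and [b]. *)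
Lemma btw_anti a b c : btw a b c -> btw a c b -> b = c.
Proof.
move=> abc acb; have [p pP] := spath_exists a c.
have [/and3P[pe Up /eqP lp]] := (pP, btwP _ _ _ abc).
move/(_ p pe lp); rewrite inE => /predU1P[ba|bp].
  by move: acb; rewrite ba /btw orbA orbb => /orP[/eqP|]; rewrite ?connect0.
apply/eqP/negPn/negP=> neq_bc.
case/splitPr: bp pe Up lp {pP} => p1 [|v p2].
  by rewrite last_cat /= => _ _ bc; rewrite bc eqxx in neq_bc.
rewrite -cat_rcons -cat_cons cat_uniq cat_path last_cat /= => /andP[p1P _].
case/and3P=> _ dis _ lp.
have /hasPn disP : ~~ has (mem (a :: rcons p1 b)) (v :: p2) by [].
have /disP/negP[] : c \in v :: p2 by rewrite -lp mem_last.
by apply: (btwP _ _ _ acb) => //; rewrite last_rcons.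
Qed.

(** A simple path from [x] to [z] either meets [y] or can be prolonged by [y] in front. So every
    vertex is on one side of the edge: [btw y x z] puts [z] on the side of [x]. *)
Lemma edge_btw x y z : e x y -> btw y x z || btw x y z.
Proof.
move=> exy; have [p pP] := spath_exists x z.
have [yp | yNp] := boolP (y \in x :: p); first by rewrite (spath_btw pP yp) orbT.
case/and3P: pP => pe Up lp.
rewrite (@spath_btw y z (x :: p)) ?inE ?eqxx ?orbT //.
by rewrite /spath [path _ _ _]/= e_sym exy pe cons_uniq yNp Up lp.
Qed.

(** * MV sets and independent sets in terms of betweenness *)

(** Paths in a tree are unique, so two vertices are [X]-visible exactly when no third vertex of [X]
    lies between them. *)
Lemma mv_setP (X : {set T}) :
  reflect {in X & &, forall a b c, b != a -> b != c -> a != c -> ~~ btw a b c}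
          (mv_set e X).
Proof.
apply: (iffP idP) => [mvX a b c aX bX cX ba bc ac | mvX].
  have /visibleP[p /geodesicP[/and3P[pe _ /eqP lp] _] pX] : visible e X a c.
    by move/forall_inP/(_ a aX)/forall_inP/(_ c cX): mvX; rewrite ac.
  apply/negP=> /btwP/(_ p pe lp) bp.
  suff /pX : b \in internal a p by rewrite bX.
  move: bp; rewrite lastI mem_rcons inE lp (negPf bc) /internal /=.
  by case: p {pe lp pX} => //= v p; rewrite inE (negPf ba).
apply/forall_inP=> a aX; apply/forall_inP=> c cX; apply/implyP=> ac.
have [p pP] := spath_exists a c; apply/visibleP; exists p.
  apply/geodesicP; split=> // q /and3P[qe _ /eqP lq].
  case/and3P: (pP) => _ Up _.
  (* By [spath_btw], [q] passes through all the distinct vertices of [p], so [p] is a geodesic. *)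
  have := @uniq_leq_size _ (a :: p) (a :: q) Up; apply=> b.
  by move/(spath_btw pP)/btwP; apply.
move=> b bp; apply/negP=> bX.
have bap : b \in belast a p by apply: mem_behead.
have /(spath_btw pP) abc : b \in a :: p by apply: mem_belast.
case/and3P: pP => _ Up /eqP lp.
apply/negP: abc; apply: mvX => //.
  move: Up bp; rewrite /internal; case: p {bap lp} => //= v p /andP[aNp _] bp.
  by apply: contraNneq aNp => <-; apply: mem_belast.
move: Up; rewrite lastI rcons_uniq lp => /andP[cNp _].
by apply: contraNneq cNp => <-.
Qed.

Lemma independentP (X : {set T}) :
  reflect {in X &, forall a b, ~~ e a b} (independent e X).
Proof.
apply: (iffP forall_inP) => [indX a b aX bX | indX a aX].
  have [-> | ab] := eqVneq a b; first by rewrite e_irr.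
  by move/forall_inP/(_ b bX): (indX a aX); rewrite ab.
by apply/forall_inP=> b bX; apply/implyP=> _; apply: indX.
Qed.

Lemma mv_edge (X : {set T}) x y z :
  mv_set e X -> x \in X -> y \in X -> e x y -> z \in X -> z \in [set x; y].
Proof.
move=> /mv_setP mvX xX yX exy zX; apply/negPn/negP.
rewrite !inE negb_or => /andP[zx zy].
have neq_xy : x != y by apply: contraTneq exy => ->; rewrite e_irr.
case/orP: (edge_btw z exy); apply/negP; apply: mvX => //; by rewrite eq_sym.
Qed.

Lemma mv_set_setU1 (X : {set T}) x :
    mv_set e X -> {in X &, forall b c, b != c -> ~~ btw b x c} ->
    {in X &, forall b c, b != c -> ~~ btw x b c} ->
  mv_set e (x |: X).
Proof.
move=> /mv_setP mvX midX endX; apply/mv_setP=> a b c.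
case/setU1P=> [->|aX] /setU1P[->|bX] /setU1P[->|cX]; rewrite ?eqxx //.
- by move=> _ bc _; apply: endX.
- by move=> _ _; apply: midX.
- by move=> ba _ _; rewrite btw_sym; apply: endX.
- exact: mvX.
Qed.

Lemma independent_setU1 (X : {set T}) x :
  independent e X -> {in X, forall b, ~~ e x b} -> independent e (x |: X).
Proof.
move=> /independentP indX xX; apply/independentP=> a b.
case/setU1P=> [->|aX] /setU1P[->|bX]; rewrite ?e_irr ?xX //.
  by rewrite e_sym xX.
exact: indX.
Qed.

Lemma mv_setS (X Y : {set T}) : X \subset Y -> mv_set e Y -> mv_set e X.
Proof.
by move=> /subsetP sXY /mv_setP mvY; apply/mv_setP=> a b c /sXY ? /sXY ? /sXY ?;
  apply: mvY.
Qed.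

(** * Splitting an edge and another MV set into two IMV sets *)

(** Here [w] is on the side of [y] and stands in for it: a vertex on the side of [x] that hides
    another from [y] also hides it from [w], though [Z] is MV. An edge within this part of [Z] would
    leave no room for [w] in [Z]. *)
Lemma imv_split_far (Z : {set T}) x y w :
    mv_set e Z -> e x y -> x \notin Z -> y \notin Z -> w \in Z ->
    btw x y w -> imv_set e (y |: [set z in Z | btw y x z]).
Proof.
move=> mvZ exy xZ yZ wZ xyw; set Zx := [set z in Z | _].
have neq_xy : x != y by apply: contraTneq exy => ->; rewrite e_irr.
have ZxP z : z \in Zx -> [/\ z \in Z, btw y x z & ~~ btw x y z].
  rewrite inE => /andP[zZ yxz]; split=> //; apply/negP.
  by rewrite btw_sym in yxz; rewrite btw_sym => /(btw_anti yxz)/eqP; apply/negP.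
have wx z : z \in Zx -> w != z.
  by case/ZxP=> _ _; apply: contraNneq => <-.
have yx z : z \in Zx -> (z != x) && (z != y).
  by case/ZxP=> zZ _ _; apply/andP; split; apply: contraTneq zZ => ->.
have sZ : Zx \subset Z by apply/subsetP=> z /ZxP[].
have mvZx := mv_setS sZ mvZ.
have mvZP := mv_setP _ mvZ.
apply/andP; split.
  apply: mv_set_setU1 => // b c bX cX neq_bc.
    have [_ _ /negPf nb] := ZxP _ bX; have [_ _ /negPf nc] := ZxP _ cX.
    by apply/negP=> /(btw_tri x); rewrite btw_sym nb nc.
  have [bZ yxb nb] := ZxP _ bX; have [cZ yxc nc] := ZxP _ cX.
  have /andP[bx by_] := yx _ bX.
  (* The path from [y] to [w] stays on the side of [y], so it misses [b]; and [Z] being MV, [b] is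
     not between [w] and [c]. *)
  apply/negP=> /(btw_tri w)/orP[ybw | wbc]; last first.
    by apply/negP: wbc; apply: mvZP; rewrite ?wx // eq_sym wx.
  have /orP[ybx | xbw] := btw_tri x ybw.
    by rewrite (btw_anti ybx yxb) eqxx in bx.
  have /orP[xyb | byw] := btw_tri b xyw; first by rewrite xyb in nb.
  by rewrite btw_sym in byw; rewrite btw_sym in ybw;
    rewrite (btw_anti ybw byw) eqxx in by_.
apply: independent_setU1 => [|z zX].
  apply/independentP=> b c bX cX; apply/negP=> ebc.
  have [bZ _ _] := ZxP _ bX; have [cZ _ _] := ZxP _ cX.
  have := mv_edge mvZ bZ cZ ebc wZ.
  by rewrite !inE (negPf (wx _ bX)) (negPf (wx _ cX)).
have [_ yxz _] := ZxP _ zX; have /andP[zx _] := yx _ zX.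
by apply: btw_edge yxz _ _; rewrite // eq_sym.
Qed.

(** Since [x] shields [y] from [Z], no vertex of [Z] is adjacent to [y]. The split depends on
    whether some [z'] in [Z] hides another vertex of [Z] from [x]. *)
Lemma imv_split_near (Z : {set T}) x y :
    mv_set e Z -> e x y -> x \notin Z -> y \notin Z ->
    {in Z, forall z, btw y x z} ->
  exists A B, [/\ imv_set e A /\ imv_set e B, y \in A, x \in B,
                  [disjoint A & B] & A :|: B = [set x; y] :|: Z].
Proof.
move=> mvZ exy xZ yZ yxZ.
have neq_xy : x != y by apply: contraTneq exy => ->; rewrite e_irr.
have mvZP := mv_setP _ mvZ.
have xZP z : z \in Z -> z != x by apply: contraTneq => ->.
have nyZ z : z \in Z -> ~~ e y z.
  move=> zZ; apply: btw_edge (yxZ _ zZ) neq_xy _.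
  by rewrite eq_sym xZP.
have nxyz z : z \in Z -> ~~ btw x y z.
  move=> zZ; rewrite btw_sym; apply/negP=> zyx.
  have := yxZ _ zZ; rewrite btw_sym => zxy.
  by rewrite (btw_anti zxy zyx) eqxx in neq_xy.
have [/exists_inP[z' z'Z /exists_inP[z zZ /andP[zz' xz'z]]] | noz'] :=
  boolP [exists z' in Z, [exists z in Z, (z != z') && btw x z' z]].
  have xz' w : w \in Z -> w != z' -> btw x z' w.
    move=> wZ ww'; have [-> // | wz] := eqVneq w z.
    (* Otherwise [z'] would lie between the vertices [w] and [z] of the MV set [Z]. *)
    have /orP[// | wz'z] := btw_tri w xz'z.
    by apply: contraLR wz'z => _; apply: mvZP; rewrite // eq_sym.
  exists [set y; z'], (x |: Z :\ z'); split; [split | | | |]; rewrite ?inE ?eqxx //.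
  - apply/andP; split; last first.
      apply: independent_setU1 => [|b /set1P->]; last exact: nyZ.
      by case/andP: (imv_set1 e z').
    apply: mv_set_setU1; first exact: mv_set1.
      by move=> b c /set1P-> /set1P->; rewrite eqxx.
    by move=> b c /set1P-> /set1P->; rewrite eqxx.
  - apply/andP; split.
      apply: mv_set_setU1 => [|b c|b c]; first exact: mv_setS (subD1set _ _) mvZ.
        case/setD1P=> bz' bZ /setD1P[cz' cZ] bc.
        (* Since [z'] lies between [x] and [u], [x] cannot lie between [z'] and [u]. *)
        have no u : u \in Z -> u != z' -> btw z' x u -> False.
          move=> uZ uz'; have := xz' u uZ uz'; rewrite btw_sym => uz'x.
          rewrite btw_sym => uxz'; have /eqP := btw_anti uz'x uxz'.
          by apply/negP/xZP.
        apply/negP=> /(btw_tri z'); rewrite btw_sym.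
        by case/orP; apply: no.
      case/setD1P=> bz' bZ /setD1P[cz' cZ] bc.
      apply/negP=> /(btw_tri z')/orP[xbz' | z'bc].
        by have /eqP := btw_anti (xz' b bZ bz') xbz'; rewrite eq_sym (negPf bz').
      by apply/negP: z'bc; apply: mvZP; rewrite // eq_sym.
    apply: independent_setU1 => [|b /setD1P[bz' bZ]].
      (* An edge inside [Z] would make [Z] equal to that edge, excluding [z']. *)
      apply/independentP=> b c /setD1P[bz' bZ] /setD1P[cz' cZ]; apply/negP=> ebc.
      have := mv_edge mvZ bZ cZ ebc z'Z.
      by rewrite !inE eq_sym (negPf bz') eq_sym (negPf cz').
    by apply: btw_edge (xz' b bZ bz') _ _; rewrite ?xZP // eq_sym.
  - rewrite disjoint_subset; apply/subsetP=> u; rewrite !inE.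
    case/orP=> /eqP->; rewrite negb_or negb_and negbK.
      by rewrite eq_sym neq_xy yZ orbT.
    by rewrite xZP ?eqxx.
  - apply/setP=> u; rewrite !inE; case: (eqVneq u z') => [->|_]; rewrite ?z'Z ?orbT //=.
    by rewrite orbF orbCA orbA.
have nz b c : b \in Z -> c \in Z -> b != c -> ~~ btw x b c.
  move=> bZ cZ bc; apply: contra noz' => xbc.
  by apply/exists_inP; exists b => //; apply/exists_inP; exists c; rewrite // eq_sym bc.
exists (y |: Z), [set x]; split; [split | | | |]; rewrite ?inE ?eqxx ?imv_set1 //.
- apply/andP; split.
    apply: mv_set_setU1 => // b c bZ cZ bc.
      apply/negP=> /(btw_tri x); rewrite btw_sym.
      by rewrite (negPf (nxyz _ bZ)) (negPf (nxyz _ cZ)).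
    apply/negP=> /(btw_tri x)/orP[ybx | ]; last by apply/negP/nz.
    have /eqP := btw_anti (yxZ _ bZ) ybx; by rewrite eq_sym (negPf (xZP _ bZ)).
  apply: independent_setU1 => [|b]; last exact: nyZ.
  (* An edge inside [Z] would have one end between [x] and the other end. *)
  apply/independentP=> b c bZ cZ; apply/negP=> ebc.
  have neq_bc : b != c by apply: contraTneq ebc => ->; rewrite e_irr.
  have /orP[] := edge_btw x ebc; rewrite btw_sym; apply/negP; apply: nz => //.
  by rewrite eq_sym.
- by rewrite disjoint_sym disjoints1 !inE negb_or neq_xy.
- by apply/setP=> u; rewrite !inE orbC orbA.
Qed.

Lemma imv_split (Z : {set T}) x y :
    mv_set e Z -> e x y -> x \notin Z -> y \notin Z ->
  exists A B, [/\ imv_set e A /\ imv_set e B, y \in A, x \in B,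
                  [disjoint A & B] & A :|: B = [set x; y] :|: Z].
Proof.
move=> mvZ exy xZ yZ; have eyx : e y x by rewrite e_sym.
have neq_xy : x != y by apply: contraTneq exy => ->; rewrite e_irr.
have side z : btw y x z || btw x y z := edge_btw z exy.
have not_both z : btw y x z -> ~~ btw x y z.
  rewrite btw_sym => zxy; rewrite btw_sym; apply/negP=> zyx.
  by rewrite (btw_anti zxy zyx) eqxx in neq_xy.
have [/exists_inP[w wZ xyw] | noy] := boolP [exists w in Z, btw x y w]; last first.
  apply: imv_split_near => // z zZ; have /orP[// | xyz] := side z.
  by case/negP: noy; apply/exists_inP; exists z.
have [/exists_inP[v vZ yxv] | nox] := boolP [exists v in Z, btw y x v]; last first.
  (* All of [Z] is on the side of [y]: exchange the roles of [x] and [y]. *)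
  have [|A [B [[imvA imvB] xA yB disAB defZ]]] := imv_split_near mvZ eyx yZ xZ.
    move=> z zZ; have /orP[yxz | //] := side z.
    by case/negP: nox; apply/exists_inP; exists z.
  exists B, A; split; [split | | | |];
    by rewrite // 1?disjoint_sym // setUC defZ [[set y; x]](setUC [set y]).
(* Each end of the edge takes the part of [Z] on the opposite side; [w] and [v] serve as the far
   witnesses. *)
exists (y |: [set z in Z | btw y x z]), (x |: [set z in Z | btw x y z]).
split; [split | | | |]; rewrite ?inE ?eqxx //.
- exact: imv_split_far wZ xyw.
- exact: imv_split_far vZ yxv.
- rewrite -setI_eq0; apply/eqP/setP=> u; rewrite !inE.
  have [-> | ux] := eqVneq u x.
    by rewrite (negPf neq_xy) (negPf xZ).
  have [-> | uy] := eqVneq u y; first by rewrite (negPf yZ).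
  by have := not_both u; case: (btw y x u) => [/(_ isT)/negPf->|_] /=; rewrite ?andbF.
- apply/setP=> u; rewrite !inE.
  by case/orP: (side u) => ->; case: (u == x); case: (u == y); case: (u \in Z);
    rewrite /= ?orbT.
Qed.

End Betweenness.

(** * Exchanging classes of a partition *)

(** Removing [X] and [Z] leaves a partition of the rest of [D], to which [B] and then [A] are added.
    Being nonempty and disjoint from what is covered so far, each is a new class, so the count is
    restored. *)
Lemma partition_exchange (T : finType) (P : {set {set T}}) (D X Z A B : {set T}) :
    partition P D -> X \in P -> Z \in P -> X != Z -> A != set0 -> B != set0 ->
    [disjoint A & B] -> A :|: B = X :|: Z ->
  partition (A |: (B |: P :\ X :\ Z)) D
    /\ #|A |: (B |: P :\ X :\ Z)| = #|P|.
Proof.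
move=> partP XP ZP XZ A0 B0 disAB defAB.
have ZP' : Z \in P :\ X by rewrite !inE eq_sym XZ.
have partP2 := partitionD1 (partitionD1 partP XP) ZP'.
have defD : A :|: (B :|: (D :\: X :\: Z)) = D.
  rewrite setUA defAB setDDl setDE setUIr setUCr setIT.
  by apply/setUidPr; rewrite subUset !(partitionS partP).
have disB : [disjoint B & D :\: X :\: Z].
  rewrite setDDl -defAB disjoints_subset; apply/subsetP=> u uB.
  by rewrite in_setC in_setD in_setU uB orbT.
have partB := partitionU1 partP2 B0 disB.
have disA : [disjoint A & B :|: (D :\: X :\: Z)].
  rewrite disjoints_subset; apply/subsetP=> u uA.
  by rewrite setDDl -defAB in_setC in_setU in_setD in_setU uA (disjointFr disAB uA).
have partA := partitionU1 partB A0 disA.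
split; first by rewrite -[X in partition _ X]defD.
have notin (Q : {set {set T}}) E C :
    partition Q E -> C != set0 -> [disjoint C & E] -> C \notin Q.
  move=> partQ C0 disC; apply: contraNN C0 => CQ.
  by rewrite -(setIidPl (partitionS partQ CQ)) setI_eq0.
rewrite !cardsU1 (notin _ _ _ partB) ?(notin _ _ _ partP2) //.
by rewrite (cardsD1 X P) XP (cardsD1 Z (P :\ X)) ZP'.
Qed.

(** Induction on the number of classes that are MV but not independent. *)
Lemma partitionable_imv (T : finType) (e : rel T) k :
  tree e -> 2 < #|T| -> partitionable (mv_set e) k -> partitionable (imv_set e) k.
Proof.
move=> treeT T_gt2 /existsP[P].
pose bad (P : {set {set T}}) := [set X in P | ~~ imv_set e X].
have [n] := ubnP #|bad P|; elim: n P => // n IHn P; rewrite ltnS => bad_n.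
case/and3P=> partP cardP /forall_inP mvP.
have [bad0 | [X]] := set_0Vmem (bad P).
  apply/existsP; exists P; rewrite partP cardP; apply/forall_inP=> X XP.
  by apply: contraFT (in_set0 X) => imvX; rewrite -bad0 inE XP.
rewrite inE => /andP[XP badX]; have mvX := mvP X XP.
move: (badX); rewrite /imv_set mvX /=.
case/forall_inPn=> x xX /forall_inPn[y yX]; rewrite negb_imply negbK => /andP[neq_xy exy].
have defX : X = [set x; y].
  apply/eqP; rewrite eqEsubset; apply/andP; split; apply/subsetP=> z.
    exact: (mv_edge treeT mvX xX yX exy).
  by case/set2P=> ->.
(* The third vertex of the tree enters here: [X] has only two. *)
have /set0Pn[z] : ~: X != set0.
  by rewrite -card_gt0 cardsCs setCK subn_gt0 defX cards2 neq_xy.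
rewrite inE => zX; have covP : cover P = setT by case/and3P: partP => /eqP.
pose Z := pblock P z; have ZP : Z \in P by rewrite pblock_mem ?covP.
have zZ : z \in Z by rewrite mem_pblock covP.
have XZ : X != Z by apply: contraNneq zX => ->.
have disXZ : [disjoint X & Z] by have /trivIsetP := partition_trivIset partP; apply.
have [A [B [[imvA imvB] yA xB disAB]]] :=
  imv_split treeT (mvP _ ZP) exy (negbT (disjointFr disXZ xX)) (negbT (disjointFr disXZ yX)).
rewrite -defX => defAB.
have A0 : A != set0 by apply/set0Pn; exists y.
have B0 : B != set0 by apply/set0Pn; exists x.
have [partQ cardQ] := partition_exchange partP XP ZP XZ A0 B0 disAB defAB.
apply: (IHn (A |: (B |: P :\ X :\ Z))).
  (* Every bad class of the new partition was already bad in [P], while [X] has disappeared: it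
     differs from [A] and [B], which are IMV. *)
  apply: leq_trans bad_n; apply: proper_card; apply/properP; split.
    apply/subsetP=> C; rewrite !inE => /andP[].
    by case/or3P=> [/eqP->|/eqP->|/and3P[_ _ ->]]; rewrite ?imvA ?imvB.
  exists X; rewrite !inE ?XP ?badX // eqxx /= andbF orbF andbT.
  by apply: contraNN badX => /orP[]/eqP->.
rewrite partQ cardQ cardP; apply/forall_inP=> C; rewrite !inE.
case/or3P=> [/eqP->|/eqP->|/and3P[_ _ /mvP//]]; first by case/andP: imvA.
by case/andP: imvB.
Qed.

Theorem theorem4p7 (T : finType) (e : rel T) (treeT : tree e)
  (T_ge3 : 3 <= #|T|) : chi_mui e = chi_mu e.
Proof.
rewrite /chi_mui /chi_mu; case: ex_minnP => k imv_k min_k.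
case: ex_minnP => m mv_m min_m; apply/eqP; rewrite eqn_leq.
(* One inequality comes from the exchanges; for the other, a partition into IMV sets is one into MV
   sets. *)
rewrite min_k ?partitionable_imv //= min_m //.
case/existsP: imv_k => P /and3P[partP cardP /forall_inP imvP].
apply/existsP; exists P; rewrite partP cardP; apply/forall_inP=> X /imvP.
by case/andP.
Qed.
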